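(* For any field $k$, the PROP $\mathtt{FinRel}_k$ is generated by the following morphisms, i.e. every morphism of $\mathtt{FinRel}_k$ can be obtained from them using composition, tensor product (direct sum), identity morphisms and the braiding: addition $+\colon k\oplus k\nrightarrow k$, $+=\{(x,y,x+y):x,y\in k\}$; zero $0\colon\{0\}\nrightarrow k$, $0=\{(0,0)\}$; duplication $\Delta\colon k\nrightarrow k\oplus k$, $\Delta=\{(x,x,x):x\in k\}$; deletion $!\colon k\nrightarrow\{0\}$, $!=\{(x,0):x\in k\}$; scaling $s_c\colon k\nrightarrow k$, $s_c=\{(x,cx):x\in k\}$, for any $c\in k$; cup $\cup\colon k\oplus k\nrightarrow\{0\}$, $\cup=\{(x,x,0):x\in k\}$; cap $\cap\colon\{0\}\nrightarrow k\oplus k$, $\cap=\{(0,x,x):x\in k\}$.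
   Context: A PROP is a strict symmetric monoidal category whose objects are the natural numbers, with monoidal product of objects given by addition. A linear relation $L\colon U\nrightarrow V$ between vector spaces is a linear subspace $L\subseteq U\oplus V$. Composition of $L\colon U\nrightarrow V$ and $L'\colon V\nrightarrow W$ is $L'L=\{(u,w):\exists v\in V,\ (u,v)\in L,\ (v,w)\in L'\}$. The direct sum of $L\colon U\nrightarrow V$ and $L'\colon U'\nrightarrow V'$ is $\{(u,u',v,v'):(u,v)\in L,(u',v')\in L'\}$. $\mathtt{FinRel}_k$ is the PROP whose morphisms $m\to n$ are linear relations $k^m\nrightarrow k^n$, with this composition and direct sum as tensor product; the braiding is the graph of $(x,y)\mapsto(y,x)$. *)

(* Defs.v *)
From HB Require Import structures.
From mathcomp Require Import all_boot all_order all_algebra.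

Set Implicit Arguments.
Unset Strict Implicit.
Unset Printing Implicit Defensive.

Import GRing.Theory.

(* Transport of a morphism along equalities of its source and target.  The     *)
(* equations between objects of a PROP, such as m + (n + p) = (m + n) + p, do  *)
(* not all hold by conversion, so the strictness laws below need it.           *)
Definition cast_hom (hom : nat -> nat -> Type) (m m' n n' : nat)
    (em : m = m') (en : n = n') (f : hom m n) : hom m' n' :=
  ecast i (hom i n') em (ecast j (hom m j) en f).

(* A strict symmetric monoidal category with set of objects nat, the tensor    *)
(* product of objects being addition and the unit object 0.                    *)
(* [pcomp P g f] is "g after f".                                               *)
Record PROP := MkPROP {
  phom : nat -> nat -> Type;
  pid : forall n, phom n n;
  pcomp : forall m n p, phom n p -> phom m n -> phom m p;
  ptens : forall m n m' n', phom m n -> phom m' n' ->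
    phom (m + m')%N (n + n')%N;
  pbraid : forall m n, phom (m + n)%N (n + m)%N;

  pcompA : forall m n p q (h : phom p q) (g : phom n p) (f : phom m n),
    pcomp h (pcomp g f) = pcomp (pcomp h g) f;
  pcomp1f : forall m n (f : phom m n), pcomp (pid n) f = f;
  pcompf1 : forall m n (f : phom m n), pcomp f (pid m) = f;

  ptens11 : forall m n, ptens (pid m) (pid n) = pid (m + n)%N;
  ptens_comp : forall m n p m' n' p' (g : phom n p) (f : phom m n)
      (g' : phom n' p') (f' : phom m' n'),
    ptens (pcomp g f) (pcomp g' f') = pcomp (ptens g g') (ptens f f');

  ptensA : forall m n m' n' m'' n'' (f : phom m n) (g : phom m' n')
      (h : phom m'' n''),
    cast_hom (addnA m m' m'') (addnA n n' n'') (ptens f (ptens g h)) =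
      ptens (ptens f g) h;
  ptens1f : forall m n (f : phom m n),
    cast_hom (add0n m) (add0n n) (ptens (pid 0) f) = f;
  ptensf1 : forall m n (f : phom m n),
    cast_hom (addn0 m) (addn0 n) (ptens f (pid 0)) = f;

  pbraid_nat : forall m n m' n' (f : phom m n) (g : phom m' n'),
    pcomp (pbraid n n') (ptens f g) = pcomp (ptens g f) (pbraid m m');
  pbraidK : forall m n, pcomp (pbraid n m) (pbraid m n) = pid (m + n)%N;
  pbraid_hexagon : forall m n p,
    cast_hom (addnA m n p) (erefl (n + p + m)%N) (pbraid m (n + p)) =
    cast_hom (erefl (m + n + p)%N) (addnA n p m)
      (pcomp (ptens (pid n) (pbraid m p))
         (cast_hom (erefl (m + n + p)%N) (esym (addnA n m p))
            (ptens (pbraid m n) (pid p))))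
}.

(* The morphisms of P obtained from those satisfying G. *)
Inductive generated (P : PROP) (G : forall m n, phom P m n -> Prop) :
    forall m n, phom P m n -> Prop :=
  | gen_gen m n (f : phom P m n) : G m n f -> generated G f
  | gen_id n : generated G (pid P n)
  | gen_braid m n : generated G (pbraid P m n)
  | gen_comp m n p (g : phom P n p) (f : phom P m n) :
      generated G g -> generated G f -> generated G (pcomp g f)
  | gen_tens m n m' n' (f : phom P m n) (g : phom P m' n') :
      generated G f -> generated G g -> generated G (ptens f g).

Definition is_generated_by (P : PROP) (G : forall m n, phom P m n -> Prop) :=
  forall m n (f : phom P m n), generated G f.

Local Open Scope ring_scope.

Definition linrel (k : fieldType) (m n : nat) : Type :=
  {vspace 'rV[k]_m * 'rV[k]_n}.

Lemma linfun_linear (k : fieldType) (U V : vectType k) (f : U -> V) :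
  linear f -> linfun f =1 f.
Proof.
move=> lf.
pose F : {linear U -> V} :=
  HB.pack f (GRing.isLinear.Build k U V *:%R f lf).
exact: (lfunE F).
Qed.

Lemma mem_limg_linfun (k : fieldType) (U V : vectType k) (f : U -> V) (v : V) :
  linear f -> reflect (exists u, v = f u) (v \in limg (linfun f)).
Proof.
move=> lf; apply: (iffP memv_imgP) => [[u _ ->]|[u ->]].
  by exists u; rewrite linfun_linear.
by exists u; rewrite ?memvf ?linfun_linear.
Qed.

Section LinearRelations.
Variable k : fieldType.

(* The operations on linear relations are built from images and preimages of   *)
(* subspaces under linear maps; the lemmas mem_* give their elements.          *)

Definition rel_id n : linrel k n n :=
  limg (linfun (fun x : 'rV[k]_n => (x, x))).

Definition rel_comp m n p (L' : linrel k n p) (L : linrel k m n) :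
    linrel k m p :=
  (linfun (fun t : 'rV[k]_m * 'rV[k]_n * 'rV[k]_p => (t.1.1, t.2)) @:
    (linfun (fun t : 'rV[k]_m * 'rV[k]_n * 'rV[k]_p => t.1) @^-1: L
     :&: linfun (fun t : 'rV[k]_m * 'rV[k]_n * 'rV[k]_p => (t.1.2, t.2))
           @^-1: L'))%VS.

Definition rel_tens m n m' n' (L : linrel k m n) (L' : linrel k m' n') :
    linrel k (m + m') (n + n') :=
  (linfun (fun t : 'rV[k]_(m + m') * 'rV[k]_(n + n') =>
             (lsubmx t.1, lsubmx t.2)) @^-1: L
   :&: linfun (fun t : 'rV[k]_(m + m') * 'rV[k]_(n + n') =>
             (rsubmx t.1, rsubmx t.2)) @^-1: L')%VS.

Definition rel_braid m n : linrel k (m + n) (n + m) :=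
  limg (linfun (fun t : 'rV[k]_m * 'rV[k]_n =>
                  (row_mx t.1 t.2, row_mx t.2 t.1))).

Definition rel_add : linrel k (1 + 1) 1 :=
  limg (linfun (fun t : 'rV[k]_1 * 'rV[k]_1 => (row_mx t.1 t.2, t.1 + t.2))).

Definition rel_zero : linrel k 0 1 := 0%VS.

Definition rel_dup : linrel k 1 (1 + 1) :=
  limg (linfun (fun x : 'rV[k]_1 => (x, row_mx x x))).

Definition rel_del : linrel k 1 0 :=
  limg (linfun (fun x : 'rV[k]_1 => (x, 0 : 'rV[k]_0))).

Definition rel_scale (c : k) : linrel k 1 1 :=
  limg (linfun (fun x : 'rV[k]_1 => (x, c *: x))).

Definition rel_cup : linrel k (1 + 1) 0 :=
  limg (linfun (fun x : 'rV[k]_1 => (row_mx x x, 0 : 'rV[k]_0))).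

Definition rel_cap : linrel k 0 (1 + 1) :=
  limg (linfun (fun x : 'rV[k]_1 => (0 : 'rV[k]_0, row_mx x x))).

Local Ltac lin :=
  let a := fresh in let u := fresh in let v := fresh in
  move=> a u v; rewrite /= -?[_ *: (_, _)]/(_, _) -?[(_, _) + _]/(_, _) /=;
  rewrite ?scale_row_mx ?add_row_mx ?scaler0 ?addr0 ?scalerDr
    ?scalerA ?(mulrC a) ?linearP //=.

Lemma mem_rel_id n x y : reflect (x = y) ((x, y) \in rel_id n).
Proof.
apply: (iffP (mem_limg_linfun _ _)) => [|[u [-> ->]] //|->]; first by lin.
by exists y.
Qed.

Lemma mem_rel_comp m n p (L' : linrel k n p) (L : linrel k m n) u w :
  reflect (exists v, (u, v) \in L /\ (v, w) \in L') ((u, w) \in rel_comp L' L).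
Proof.
apply: (iffP memv_imgP).
  case=> -[[u1 v] w1]; rewrite memv_cap -!memv_preim !linfun_linear; do ?by lin.
  by move=> /andP[/= Lu Lw] [-> ->]; exists v.
case=> v [Lu Lw]; exists (u, v, w); last by rewrite linfun_linear //; lin.
by rewrite memv_cap -!memv_preim !linfun_linear ?Lu ?Lw //; lin.
Qed.

Lemma mem_rel_tens m n m' n' (L : linrel k m n) (L' : linrel k m' n')
    u u' v v' :
  ((row_mx u u', row_mx v v') \in rel_tens L L') =
    ((u, v) \in L) && ((u', v') \in L').
Proof.
rewrite memv_cap -!memv_preim !linfun_linear /= ?row_mxKl ?row_mxKr //.
  by move=> a x y; rewrite /= !linearP.
by move=> a x y; rewrite /= !linearP.
Qed.

Lemma mem_rel_braid m n x y x' y' :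
  ((row_mx x y, row_mx y' x') \in rel_braid m n) = (x == x') && (y == y').
Proof.
apply/(mem_limg_linfun _ _)/andP => [|[[a b] /=]|[/eqP<- /eqP<-]].
- by lin.
- by case=> /eq_row_mx[-> ->] /eq_row_mx[-> ->].
- by exists (x, y).
Qed.

Lemma mem_rel_add a b :
  reflect (exists x y, a = row_mx x y /\ b = x + y) ((a, b) \in rel_add).
Proof.
apply: (iffP (mem_limg_linfun _ _)) => [|[[x y] /= [-> ->]]|[x [y [-> ->]]]].
- by lin; rewrite addrACA.
- by exists x, y.
- by exists (x, y).
Qed.

Lemma mem_rel_zero a b : reflect (a = 0 /\ b = 0) ((a, b) \in rel_zero).
Proof. by rewrite memv0; apply: (iffP eqP) => [[-> ->]|[-> ->]]. Qed.

Lemma mem_rel_dup a b :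
  reflect (exists x, a = x /\ b = row_mx x x) ((a, b) \in rel_dup).
Proof.
apply: (iffP (mem_limg_linfun _ _)) => [|[x [-> ->]]|[x [-> ->]]];
  [by lin | by exists x ..].
Qed.

Lemma mem_rel_del a b :
  reflect (exists x, a = x /\ b = 0) ((a, b) \in rel_del).
Proof.
apply: (iffP (mem_limg_linfun _ _)) => [|[x [-> ->]]|[x [-> ->]]];
  [by lin | by exists x ..].
Qed.

Lemma mem_rel_scale c a b :
  reflect (exists x, a = x /\ b = c *: x) ((a, b) \in rel_scale c).
Proof.
apply: (iffP (mem_limg_linfun _ _)) => [|[x [-> ->]]|[x [-> ->]]];
  [by lin | by exists x ..].
Qed.

Lemma mem_rel_cup a b :
  reflect (exists x, a = row_mx x x /\ b = 0) ((a, b) \in rel_cup).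
Proof.
apply: (iffP (mem_limg_linfun _ _)) => [|[x [-> ->]]|[x [-> ->]]];
  [by lin | by exists x ..].
Qed.

Lemma mem_rel_cap a b :
  reflect (exists x, a = 0 /\ b = row_mx x x) ((a, b) \in rel_cap).
Proof.
apply: (iffP (mem_limg_linfun _ _)) => [|[x [-> ->]]|[x [-> ->]]];
  [by lin | by exists x ..].
Qed.

Lemma linrelP m n (L L' : linrel k m n) :
  (forall x y, ((x, y) \in L) = ((x, y) \in L')) -> L = L'.
Proof. by move=> eqL; apply/vspaceP=> -[x y]; apply: eqL. Qed.

Lemma mem_cast_hom m m' n n' (em : m = m') (en : n = n') (L : linrel k m n)
    x y :
  ((castmx (erefl, em) x, castmx (erefl, en) y) \in cast_hom em en L) =
    ((x, y) \in L).
Proof. by case: m' / em; case: n' / en; rewrite !castmx_id. Qed.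

Lemma row_mxA_cast m n p (a : 'rV[k]_m) (b : 'rV[k]_n) (c : 'rV[k]_p) :
  row_mx (row_mx a b) c =
    castmx (erefl, addnA m n p) (row_mx a (row_mx b c)).
Proof.
rewrite row_mxA castmx_comp (eq_irrelevance (etrans _ (addnA m n p)) erefl).
by rewrite castmx_id.
Qed.

Lemma row_mx0_cast n (z : 'rV[k]_n) :
  z = castmx (erefl, addn0 n) (row_mx z (0 : 'rV_0)).
Proof.
apply/matrixP=> i j; rewrite castmxE cast_ord_id.
have -> : cast_ord (esym (addn0 n)) j = lshift 0 j by apply: val_inj.
by rewrite row_mxEl.
Qed.

Lemma rel_compA m n p q (h : linrel k p q) (g : linrel k n p)
    (f : linrel k m n) :
  rel_comp h (rel_comp g f) = rel_comp (rel_comp h g) f.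
Proof.
apply: linrelP => x y; apply/mem_rel_comp/mem_rel_comp.
  case=> v [/mem_rel_comp[u [fu gu]] hv]; exists u; split=> //.
  by apply/mem_rel_comp; exists v.
case=> u [fu /mem_rel_comp[v [gu hv]]]; exists v; split=> //.
by apply/mem_rel_comp; exists u.
Qed.

Lemma rel_comp1f m n (f : linrel k m n) : rel_comp (rel_id n) f = f.
Proof.
apply: linrelP => x y; apply/mem_rel_comp/idP => [[v [fv /mem_rel_id <-]] //|fy].
by exists y; split=> //; apply/mem_rel_id.
Qed.

Lemma rel_compf1 m n (f : linrel k m n) : rel_comp f (rel_id m) = f.
Proof.
apply: linrelP => x y; apply/mem_rel_comp/idP => [[v [/mem_rel_id -> //]]|fy].
by exists x; split=> //; apply/mem_rel_id.
Qed.

Lemma rel_tens11 m n : rel_tens (rel_id m) (rel_id n) = rel_id (m + n).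
Proof.
apply: linrelP => x y; rewrite -[x]hsubmxK -[y]hsubmxK mem_rel_tens.
apply/andP/mem_rel_id => [[/mem_rel_id-> /mem_rel_id->] //|/eq_row_mx[-> ->]].
by split; apply/mem_rel_id.
Qed.

Lemma rel_tens_comp m n p m' n' p' (g : linrel k n p) (f : linrel k m n)
    (g' : linrel k n' p') (f' : linrel k m' n') :
  rel_tens (rel_comp g f) (rel_comp g' f') =
    rel_comp (rel_tens g g') (rel_tens f f').
Proof.
apply: linrelP => x y; rewrite -[x]hsubmxK -[y]hsubmxK mem_rel_tens.
apply/andP/mem_rel_comp.
  case=> /mem_rel_comp[v [fv gv]] /mem_rel_comp[v' [fv' gv']].
  by exists (row_mx v v'); rewrite !mem_rel_tens fv gv fv' gv'.
case=> v; rewrite -[v]hsubmxK !mem_rel_tens => -[/andP[fv fv'] /andP[gv gv']].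
by split; apply/mem_rel_comp; [exists (lsubmx v) | exists (rsubmx v)].
Qed.

Lemma rel_tensA m n m' n' m'' n'' (f : linrel k m n) (g : linrel k m' n')
    (h : linrel k m'' n'') :
  cast_hom (addnA m m' m'') (addnA n n' n'') (rel_tens f (rel_tens g h)) =
    rel_tens (rel_tens f g) h.
Proof.
apply: linrelP => x y; rewrite -[x]hsubmxK -[lsubmx x]hsubmxK.
rewrite -[y]hsubmxK -[lsubmx y]hsubmxK !mem_rel_tens.
by rewrite !row_mxA_cast mem_cast_hom !mem_rel_tens andbA.
Qed.

Lemma rel_tens1f m n (f : linrel k m n) :
  cast_hom (add0n m) (add0n n) (rel_tens (rel_id 0) f) = f.
Proof.
apply: linrelP => x y.
have Ex i (z : 'rV[k]_i) : z = castmx (erefl, add0n i) (row_mx (0 : 'rV_0) z).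
  by rewrite row_thin_mx (eq_irrelevance (add0n i) erefl) castmx_id.
rewrite [x in LHS]Ex [y in LHS]Ex mem_cast_hom mem_rel_tens.
by have /mem_rel_id-> : (0 : 'rV[k]_0) = 0.
Qed.

Lemma rel_tensf1 m n (f : linrel k m n) :
  cast_hom (addn0 m) (addn0 n) (rel_tens f (rel_id 0)) = f.
Proof.
apply: linrelP => x y.
rewrite [x in LHS]row_mx0_cast [y in LHS]row_mx0_cast mem_cast_hom mem_rel_tens.
by have /mem_rel_id-> : (0 : 'rV[k]_0) = 0; rewrite ?andbT.
Qed.

Lemma rel_braid_nat m n m' n' (f : linrel k m n) (g : linrel k m' n') :
  rel_comp (rel_braid n n') (rel_tens f g) =
    rel_comp (rel_tens g f) (rel_braid m m').
Proof.
apply: linrelP => x y; rewrite -[x]hsubmxK -[y]hsubmxK.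
apply/mem_rel_comp/mem_rel_comp => -[v]; rewrite -[v]hsubmxK.
  rewrite mem_rel_tens mem_rel_braid => -[/andP[fx gx] /andP[/eqP<- /eqP<-]].
  exists (row_mx (rsubmx x) (lsubmx x)).
  by rewrite mem_rel_braid mem_rel_tens !eqxx fx gx.
rewrite mem_rel_tens mem_rel_braid => -[/andP[/eqP<- /eqP<-] /andP[gx fx]].
exists (row_mx (rsubmx y) (lsubmx y)).
by rewrite mem_rel_braid mem_rel_tens !eqxx fx gx.
Qed.

Lemma rel_braidK m n :
  rel_comp (rel_braid n m) (rel_braid m n) = rel_id (m + n).
Proof.
apply: linrelP => x y; rewrite -[x]hsubmxK -[y]hsubmxK.
apply/mem_rel_comp/mem_rel_id => [[v]|/eq_row_mx[-> ->]].
  rewrite -[v]hsubmxK !mem_rel_braid.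
  by case=> /andP[/eqP-> /eqP->] /andP[/eqP-> /eqP->].
by exists (row_mx (rsubmx y) (lsubmx y)); rewrite !mem_rel_braid !eqxx.
Qed.

Lemma rel_braid_hexagon m n p :
  cast_hom (addnA m n p) (erefl (n + p + m)%N) (rel_braid m (n + p)) =
  cast_hom (erefl (m + n + p)%N) (addnA n p m)
    (rel_comp (rel_tens (rel_id n) (rel_braid m p))
       (cast_hom (erefl (m + n + p)%N) (esym (addnA n m p))
          (rel_tens (rel_braid m n) (rel_id p)))).
Proof.
have cid i (z : 'rV[k]_i) : z = castmx (erefl, erefl i) z by rewrite castmx_id.
apply: linrelP => x y.
rewrite -[x]hsubmxK -[lsubmx x]hsubmxK -[y]hsubmxK -[lsubmx y]hsubmxK.
move: (lsubmx (lsubmx x)) (rsubmx (lsubmx x)) (rsubmx x) => a b c.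
move: (lsubmx (lsubmx y)) (rsubmx (lsubmx y)) (rsubmx y) => b' c' a'.
rewrite [row_mx (row_mx a b) c in LHS]row_mxA_cast.
rewrite [row_mx (row_mx b' c') a' in LHS]cid mem_cast_hom mem_rel_braid.
rewrite [row_mx (row_mx b' c') a']row_mxA_cast.
rewrite [row_mx (row_mx a b) c]cid mem_cast_hom.
have memE v1 v2 v3 :
    (row_mx (row_mx a b) c, row_mx v1 (row_mx v2 v3))
      \in cast_hom (erefl (m + n + p)%N) (esym (addnA n m p))
            (rel_tens (rel_braid m n) (rel_id p)) =
    [&& a == v2, b == v1 & c == v3].
  have -> : row_mx v1 (row_mx v2 v3) =
      castmx (erefl, esym (addnA n m p)) (row_mx (row_mx v1 v2) v3).
    by rewrite -row_mxA.
  rewrite [row_mx (row_mx a b) c]cid mem_cast_hom mem_rel_tens mem_rel_braid.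
  by rewrite -andbA; congr [&& _, _ & _]; apply/mem_rel_id/eqP.
apply/andP/mem_rel_comp.
  case=> /eqP<- /eqP/eq_row_mx[<- <-]; exists (row_mx b (row_mx a c)).
  by rewrite memE mem_rel_tens mem_rel_braid !eqxx !andbT; split=> //;
    apply/mem_rel_id.
case=> v; rewrite -[v]hsubmxK -[rsubmx v]hsubmxK memE mem_rel_tens.
rewrite mem_rel_braid => -[/and3P[/eqP<- /eqP<- /eqP<-]].
by case/and3P=> /mem_rel_id<- /eqP<- /eqP<-.
Qed.

Definition FinRel : PROP :=
  MkPROP rel_compA rel_comp1f rel_compf1 rel_tens11 rel_tens_comp
    rel_tensA rel_tens1f rel_tensf1 rel_braid_nat rel_braidK
    rel_braid_hexagon.

Inductive FinRel_generator : forall m n, phom FinRel m n -> Prop :=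
  | FinRel_add : @FinRel_generator (1 + 1) 1 rel_add
  | FinRel_zero : @FinRel_generator 0 1 rel_zero
  | FinRel_dup : @FinRel_generator 1 (1 + 1) rel_dup
  | FinRel_del : @FinRel_generator 1 0 rel_del
  | FinRel_scale c : @FinRel_generator 1 1 (rel_scale c)
  | FinRel_cup : @FinRel_generator (1 + 1) 0 rel_cup
  | FinRel_cap : @FinRel_generator 0 (1 + 1) rel_cap.

End LinearRelations.

(* Main.v *)
Require Import Defs.
From mathcomp Require Import all_boot all_order all_algebra.
From HB Require Import structures.

Set Implicit Arguments.
Unset Strict Implicit.
Unset Printing Implicit Defensive.

Import GRing.Theory VectorInternalTheory.
Local Open Scope ring_scope.

(** Every subspace of [k^m + k^n] is the kernel of a linear map, hence the set
of pairs with [x *m A = y *m B] for two matrices [A] and [B]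
([linrel_equalizer]).  As a relation it is therefore the graph of [A] followed
by the converse of the graph of [B], and two facts finish the proof.

Graphs of matrices are generated ([generated_graph]).  A matrix is assembled
from scalars: putting a scalar on top of a column amounts to adding the two
outputs, and putting two blocks side by side amounts to duplicating the input.
The only wiring needed is the duplication of [m] wires at once, which comes
from the duplication of a single wire by shuffling wires with the braiding.

Generated relations are stable under converse ([generated_converse]).  Since
converse commutes with composition and direct sum and permutes the identities,
the braidings, the cup and the cap, it suffices to treat the other generators.
Addition, zero, duplication and deletion are bent backwards with cups and caps:
for example, [z = x + y] may be read as [x = z - y], so the converse of
addition creates a pair of equal values [y] with a cap and adds the opposite of
one of them to [z].  The converse of scaling by a nonzero [c] is scaling by
[c^-1], and scaling by zero is a deletion followed by a zero. *)

Section Generation.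
Variable k : fieldType.

Definition gen m n (f : linrel k m n) : Prop :=
  generated (P := FinRel k) (@FinRel_generator k) f.

Lemma generated_id n : gen (rel_id k n).
Proof. exact: (gen_id (P := FinRel k)). Qed.

Lemma generated_braid m n : gen (rel_braid k m n).
Proof. exact: (gen_braid (P := FinRel k)). Qed.

Lemma generated_comp m n p (g : linrel k n p) (f : linrel k m n) :
  gen g -> gen f -> gen (rel_comp g f).
Proof. exact: (gen_comp (P := FinRel k)). Qed.

Lemma generated_tens m n m' n' (f : linrel k m n) (g : linrel k m' n') :
  gen f -> gen g -> gen (rel_tens f g).
Proof. exact: (gen_tens (P := FinRel k)). Qed.

Lemma generated_cast m m' n n' (em : m = m') (en : n = n') (f : linrel k m n) :
  gen f -> gen (cast_hom em en f).
Proof. by case: m' / em; case: n' / en. Qed.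

Lemma generated_add : gen (rel_add k).
Proof. exact/gen_gen/FinRel_add. Qed.

Lemma generated_zero : gen (rel_zero k).
Proof. exact/gen_gen/FinRel_zero. Qed.

Lemma generated_dup : gen (rel_dup k).
Proof. exact/gen_gen/FinRel_dup. Qed.

Lemma generated_del : gen (rel_del k).
Proof. exact/gen_gen/FinRel_del. Qed.

Lemma generated_scale c : gen (rel_scale c).
Proof. exact/gen_gen/FinRel_scale. Qed.

Lemma generated_cup : gen (rel_cup k).
Proof. exact/gen_gen/FinRel_cup. Qed.

Lemma generated_cap : gen (rel_cap k).
Proof. exact/gen_gen/FinRel_cap. Qed.

(** * Graphs of matrices *)

Definition rel_graph m n (A : 'M[k]_(m, n)) : linrel k m n :=
  limg (linfun (fun x : 'rV[k]_m => (x, x *m A))).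

Lemma mem_rel_graph m n (A : 'M[k]_(m, n)) x y :
  ((x, y) \in rel_graph A) = (y == x *m A).
Proof.
apply/(mem_limg_linfun _ _)/eqP => [|[u [-> ->]] //|->]; last by exists x.
by move=> a u v; rewrite /= mulmxDl -scalemxAl.
Qed.

Lemma rel_graph_comp m n p (B : 'M[k]_(n, p)) (A : 'M[k]_(m, n)) :
  rel_comp (rel_graph B) (rel_graph A) = rel_graph (A *m B).
Proof.
apply: linrelP => x y; rewrite mem_rel_graph mulmxA.
apply/mem_rel_comp/eqP => [[v]|->].
  by rewrite !mem_rel_graph => -[/eqP-> /eqP->].
by exists (x *m A); rewrite !mem_rel_graph.
Qed.

Lemma rel_graph_tens m n m' n' (A : 'M[k]_(m, n)) (B : 'M[k]_(m', n')) :
  rel_tens (rel_graph A) (rel_graph B) = rel_graph (block_mx A 0 0 B).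
Proof.
apply: linrelP => x y; rewrite -[x]hsubmxK -[y]hsubmxK mem_rel_tens.
rewrite !mem_rel_graph mul_row_block !mulmx0 addr0 add0r.
by apply/andP/eqP => [[/eqP-> /eqP->]|/eq_row_mx[-> ->]].
Qed.

Lemma rel_add_graph : rel_add k = rel_graph (col_mx 1%:M 1%:M).
Proof.
apply: linrelP => x y; rewrite mem_rel_graph.
apply/mem_rel_add/eqP => [[a [b [-> ->]]]|->].
  by rewrite mul_row_col !mulmx1.
exists (lsubmx x), (rsubmx x); rewrite hsubmxK; split=> //.
by rewrite -{1}[x]hsubmxK mul_row_col !mulmx1.
Qed.

Lemma rel_dup_graph : rel_dup k = rel_graph (row_mx 1%:M 1%:M).
Proof.
apply: linrelP => x y; rewrite mem_rel_graph mul_mx_row mulmx1.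
by apply/mem_rel_dup/eqP => [[_ [<- ->]]|->] //; exists x.
Qed.

Lemma rel_scale_graph c : rel_scale c = rel_graph c%:M.
Proof.
apply: linrelP => x y; rewrite mem_rel_graph mul_mx_scalar.
by apply/mem_rel_scale/eqP => [[_ [<- ->]]|->] //; exists x.
Qed.

(** There is a single matrix with no column, so it suffices to delete the
wires one by one. *)
Lemma generated_graph_m0 m (A : 'M[k]_(m, 0)) : gen (rel_graph A).
Proof.
elim: m A => [|m IHm] A.
  suff -> : rel_graph A = rel_id k 0 by exact: generated_id.
  apply: linrelP => x y; rewrite mem_rel_graph !thinmx0 eqxx.
  by symmetry; apply/mem_rel_id.
suff -> : rel_graph A = rel_tens (rel_del k) (rel_graph (0 : 'M_(m, 0))).
  exact: generated_tens generated_del (IHm _).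
apply: linrelP => x y; rewrite -[x](@hsubmxK _ _ 1 m) -[y](@hsubmxK _ _ 0 0).
rewrite (@mem_rel_tens _ 1 0 m 0) !mem_rel_graph !thinmx0 eqxx andbT; symmetry.
by apply/mem_rel_del; exists (@lsubmx _ _ 1 m x).
Qed.

(** The column with entry [a] above a column [B] adds [a x0] to the value of [B]
on the remaining wires. *)
Lemma generated_graph_m1 m (A : 'M[k]_(m, 1)) : gen (rel_graph A).
Proof.
elim: m A => [|m IHm] A.
  suff -> : rel_graph A = rel_zero k by exact: generated_zero.
  apply: linrelP => x y; rewrite mem_rel_graph (flatmx0 A) mulmx0.
  by apply/eqP/mem_rel_zero => [->|[]] //; rewrite thinmx0.
suff -> : rel_graph A =
    rel_comp (rel_add k) (rel_tens (rel_scale (A 0 0))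
                            (rel_graph (@dsubmx _ 1 m 1 A))).
  apply: generated_comp generated_add _.
  exact: generated_tens (generated_scale _) (IHm _).
rewrite rel_add_graph rel_scale_graph rel_graph_tens rel_graph_comp.
rewrite mul_block_col !mul0mx !mulmx1 addr0 add0r.
have <- : @usubmx _ 1 m 1 A = (A 0 0)%:M.
  apply/matrixP => i j; rewrite !ord1 !mxE mulr1n.
  by congr (A _ _); apply: val_inj.
by rewrite (@vsubmxK _ 1 m 1).
Qed.

(** * Duplication of several wires *)

(** Exchanging the two middle bundles of four bundles of wires is a braiding
placed between identities, up to the associativity of addition. *)
Lemma generated_interchange m n p q :
  exists2 f : linrel k (m + n + (p + q)) (m + p + (n + q)), gen f &
    forall (a a' : 'rV_m) (b b' : 'rV_n) (c c' : 'rV_p) (d d' : 'rV_q),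
    ((row_mx (row_mx a b) (row_mx c d), row_mx (row_mx a' c') (row_mx b' d'))
      \in f) = [&& a == a', b == b', c == c' & d == d'].
Proof.
pose g : linrel k (n + (p + q)) (p + (n + q)) :=
  cast_hom (esym (addnA n p q)) (esym (addnA p n q))
    (rel_tens (rel_braid k n p) (rel_id k q)).
have g_gen : gen g.
  exact/generated_cast/generated_tens/generated_id/generated_braid.
exists (cast_hom (addnA m n (p + q)) (addnA m p (n + q))
          (rel_tens (rel_id k m) g)).
  exact/generated_cast/generated_tens/g_gen/generated_id.
move=> a a' b b' c c' d d'; rewrite !row_mxA_cast mem_cast_hom mem_rel_tens.
rewrite !row_mxA mem_cast_hom mem_rel_tens mem_rel_braid -!andbA.
by congr [&& _, _, _ & _]; apply/mem_rel_id/eqP.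
Qed.

(** Duplicating the first wire and, by induction, the bundle of the others gives
[(x0, x0, x', x')], which the interchange turns into [(x0, x', x0, x')]. *)
Lemma generated_dup_mx m : gen (rel_graph (row_mx 1%:M 1%:M : 'M_(m, m + m))).
Proof.
elim: m => [|m IHm]; first exact: generated_graph_m0.
have [f f_gen fE] := generated_interchange 1 1 m m.
pose D : 'M[k]_(1 + m, (1 + m) + (1 + m)) := row_mx 1%:M 1%:M.
suff defD : rel_graph D =
    rel_comp f (rel_tens (rel_dup k) (rel_graph (row_mx 1%:M 1%:M))).
  (* [m.+1] and [1 + m] are convertible; the latter makes blocks visible. *)
  change (gen (rel_graph D)); rewrite defD.
  exact: generated_comp f_gen (generated_tens generated_dup IHm).
apply: linrelP => x y; rewrite mem_rel_graph mul_mx_row mulmx1.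
rewrite -[y]hsubmxK; move: (lsubmx _) (rsubmx _) => y1 y2.
rewrite -[x]hsubmxK -[y1]hsubmxK -[y2]hsubmxK.
move: (lsubmx x) (rsubmx x) => x0 x'.
move: (lsubmx y1) (rsubmx y1) (lsubmx y2) (rsubmx y2) => a b c d.
rewrite rel_dup_graph rel_graph_tens.
apply/eqP/mem_rel_comp => [/eq_row_mx[/eq_row_mx[-> ->] /eq_row_mx[-> ->]]|].
  exists (row_mx (row_mx x0 x0) (row_mx x' x')); rewrite fE !eqxx; split=> //.
  rewrite -rel_graph_tens mem_rel_tens !mem_rel_graph.
  by rewrite !mul_mx_row !mulmx1 !eqxx.
case=> v; rewrite mem_rel_graph mul_row_block !mulmx0 addr0 add0r !mul_mx_row.
rewrite !mulmx1 => -[/eqP->]; rewrite fE.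
by case/and4P=> /eqP-> /eqP-> /eqP-> /eqP->.
Qed.

(** Columns are handled one at a time, each being fed its own copy of the
input. *)
Lemma generated_graph m n (A : 'M[k]_(m, n)) : gen (rel_graph A).
Proof.
elim: n A => [|n IHn] A; first exact: generated_graph_m0.
rewrite -[A](@hsubmxK _ _ 1 n).
move: (lsubmx _) (rsubmx _) => B C.
suff -> : rel_graph (row_mx B C) =
    rel_comp (rel_tens (rel_graph B) (rel_graph C))
             (rel_graph (row_mx 1%:M 1%:M)).
  apply: generated_comp (generated_dup_mx m).
  exact: generated_tens (generated_graph_m1 B) (IHn C).
rewrite rel_graph_tens rel_graph_comp mul_row_block.
by rewrite !mul1mx addr0 add0r.
Qed.

(** * Converses *)

Definition rel_converse m n (f : linrel k m n) : linrel k n m :=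
  (linfun (fun t : 'rV[k]_n * 'rV[k]_m => (t.2, t.1)) @^-1: f)%VS.

Lemma mem_rel_converse m n (f : linrel k m n) x y :
  ((y, x) \in rel_converse f) = ((x, y) \in f).
Proof. by rewrite -memv_preim linfun_linear. Qed.

Lemma rel_converse_id n : rel_converse (rel_id k n) = rel_id k n.
Proof.
apply: linrelP => x y; rewrite mem_rel_converse.
by apply/mem_rel_id/mem_rel_id.
Qed.

Lemma rel_converse_braid m n : rel_converse (rel_braid k m n) = rel_braid k n m.
Proof.
apply: linrelP => x y; rewrite mem_rel_converse -[x]hsubmxK -[y]hsubmxK.
by rewrite !mem_rel_braid andbC; congr andb; apply: eq_sym.
Qed.

Lemma rel_converse_comp m n p (g : linrel k n p) (f : linrel k m n) :
  rel_converse (rel_comp g f) = rel_comp (rel_converse f) (rel_converse g).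
Proof.
apply: linrelP => x y; rewrite mem_rel_converse.
apply/mem_rel_comp/mem_rel_comp => -[v [fv gv]]; exists v;
  by rewrite !mem_rel_converse in fv gv *.
Qed.

Lemma rel_converse_tens m n m' n' (f : linrel k m n) (g : linrel k m' n') :
  rel_converse (rel_tens f g) = rel_tens (rel_converse f) (rel_converse g).
Proof.
apply: linrelP => x y; rewrite mem_rel_converse -[x]hsubmxK -[y]hsubmxK.
by rewrite !mem_rel_tens !mem_rel_converse.
Qed.

Lemma mem_rel_capE a (x y : 'rV[k]_1) :
  ((a, row_mx x y) \in rel_cap k) = (x == y).
Proof.
apply/mem_rel_cap/eqP => [[z [_ /eq_row_mx[-> ->]]] //|->].
by exists y; rewrite thinmx0.
Qed.

Lemma mem_rel_cupE (x y : 'rV[k]_1) b :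
  ((row_mx x y, b) \in rel_cup k) = (x == y).
Proof.
apply/mem_rel_cup/eqP => [[z [/eq_row_mx[-> ->] _]] //|->].
by exists y; rewrite thinmx0.
Qed.

Lemma row_mx_nil (z : 'rV[k]_1) : row_mx z (0 : 'rV_0) = z.
Proof.
rewrite [RHS]row_mx0_cast (eq_irrelevance (addn0 1) erefl).
by rewrite castmx_id.
Qed.

(** The relation [z = x + y] is read as [x = z - y]: from [z] and a pair
[(y, y)] created by a cap, the map [(z, y, y') |-> (z - y, y')] gives
[(x, y)]. *)
Lemma generated_converse_add : gen (rel_converse (rel_add k)).
Proof.
pose M : 'M[k]_(1 + (1 + 1), 1 + 1) :=
  col_mx (row_mx 1%:M 0) (col_mx (row_mx (- 1%:M) 0) (row_mx 0 1%:M)).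
have ME z y y' : row_mx z (row_mx y y') *m M = row_mx (z - y) y'.
  rewrite !mul_row_col !mul_mx_row !mulmx0 mulmxN !mulmx1.
  by rewrite !add_row_mx !add0r !addr0.
pose N : linrel k (1 + 0) (1 + (1 + 1)) := rel_tens (rel_id k 1) (rel_cap k).
suff -> : rel_converse (rel_add k) = rel_comp (rel_graph M) N.
  apply: generated_comp (generated_graph M) _.
  exact: generated_tens (generated_id 1) generated_cap.
have NE (z z' y y' : 'rV_1) :
    ((z, row_mx z' (row_mx y y')) \in N) = (z == z') && (y == y').
  rewrite /N -[in LHS](row_mx_nil z) (@mem_rel_tens _ 1 1 0 (1 + 1))
    mem_rel_capE; congr andb.
  exact/mem_rel_id/eqP.
apply: linrelP => z v; rewrite mem_rel_converse.
apply/mem_rel_add/mem_rel_comp => [[x [y [-> ->]]]|[u]].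
  exists (row_mx (x + y) (row_mx y y)).
  by rewrite mem_rel_graph ME addrK NE !eqxx.
rewrite -[u]hsubmxK -[rsubmx u]hsubmxK NE mem_rel_graph ME.
case=> /andP[/eqP<- /eqP<-] /eqP->.
by do 2!eexists; split; [reflexivity | rewrite subrK].
Qed.

Lemma generated_converse_zero : gen (rel_converse (rel_zero k)).
Proof.
suff -> : rel_converse (rel_zero k) =
    rel_comp (rel_cup k) (rel_graph (row_mx 0 1%:M)).
  exact: generated_comp generated_cup (generated_graph _).
apply: linrelP => x y; rewrite mem_rel_converse.
apply/mem_rel_zero/mem_rel_comp => [[_ ->]|[v]].
  exists (row_mx 0 0).
  by rewrite mem_rel_cupE mem_rel_graph mul0mx row_mx0 !eqxx.
rewrite mem_rel_graph mul_mx_row mulmx0 mulmx1 => -[/eqP->].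
by rewrite mem_rel_cupE thinmx0 => /eqP<-.
Qed.

(** Two inputs [x] and [y] are compared by sending them to [(x, x, y)] and
closing the last two wires with a cup. *)
Lemma generated_converse_dup : gen (rel_converse (rel_dup k)).
Proof.
pose M : 'M[k]_(1 + 1, 1 + (1 + 1)) :=
  col_mx (row_mx 1%:M (row_mx 1%:M 0)) (row_mx 0 (row_mx 0 1%:M)).
have ME x y : row_mx x y *m M = row_mx x (row_mx x y).
  rewrite mul_row_col !mul_mx_row !mulmx0 !mulmx1.
  by rewrite !add_row_mx !add0r !addr0.
pose N : linrel k (1 + (1 + 1)) (1 + 0) := rel_tens (rel_id k 1) (rel_cup k).
suff -> : rel_converse (rel_dup k) = rel_comp N (rel_graph M).
  apply: generated_comp (generated_graph M).
  exact: generated_tens (generated_id 1) generated_cup.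
have NE (z z' y y' : 'rV_1) :
    ((row_mx z (row_mx y y'), z') \in N) = (z == z') && (y == y').
  rewrite /N -[in LHS](row_mx_nil z') (@mem_rel_tens _ 1 1 (1 + 1) 0)
    mem_rel_cupE; congr andb.
  exact/mem_rel_id/eqP.
apply: linrelP => v z; rewrite mem_rel_converse -[v]hsubmxK.
apply/mem_rel_dup/mem_rel_comp => [[_ [<- ->]]|[u]].
  by exists (row_mx z (row_mx z z)); rewrite mem_rel_graph ME NE !eqxx.
rewrite mem_rel_graph ME => -[/eqP->]; rewrite NE => /andP[/eqP-> /eqP<-].
by exists z.
Qed.

Lemma generated_converse_del : gen (rel_converse (rel_del k)).
Proof.
suff -> : rel_converse (rel_del k) =
    rel_comp (rel_graph (col_mx 0 1%:M)) (rel_cap k).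
  exact: generated_comp (generated_graph _) generated_cap.
apply: linrelP => y x; rewrite mem_rel_converse.
apply/mem_rel_del/mem_rel_comp => _; last by exists x; rewrite thinmx0.
exists (row_mx x x); rewrite mem_rel_capE mem_rel_graph mul_row_col.
by rewrite mulmx0 mulmx1 add0r !eqxx.
Qed.

(** Scaling by zero deletes its input and creates a zero. *)
Lemma generated_converse_scale c : gen (rel_converse (rel_scale c)).
Proof.
have [->|c_neq0] := eqVneq c 0.
  suff -> : rel_scale 0 = rel_comp (rel_zero k) (rel_del k).
    rewrite rel_converse_comp.
    exact: generated_comp generated_converse_del generated_converse_zero.
  apply: linrelP => x y; apply/mem_rel_scale/mem_rel_comp.
    case=> z [_ ->]; exists 0; rewrite scale0r.
    by split; [apply/mem_rel_del; exists x | apply/mem_rel_zero].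
  by case=> v [_ /mem_rel_zero[_ ->]]; exists x; rewrite scale0r.
suff -> : rel_converse (rel_scale c) = rel_scale c^-1.
  exact: generated_scale.
apply: linrelP => y x; rewrite mem_rel_converse.
apply/mem_rel_scale/mem_rel_scale => -[_ [<- ->]].
  by exists (c *: x); rewrite scalerA mulVf // scale1r.
by exists (c^-1 *: y); rewrite scalerA mulfV // scale1r.
Qed.

Lemma rel_converse_cup : rel_converse (rel_cup k) = rel_cap k.
Proof.
apply: linrelP => y x; rewrite mem_rel_converse -[x]hsubmxK.
by rewrite mem_rel_cupE mem_rel_capE.
Qed.

Lemma rel_converse_cap : rel_converse (rel_cap k) = rel_cup k.
Proof.
apply: linrelP => x y; rewrite mem_rel_converse -[x]hsubmxK.
by rewrite mem_rel_cupE mem_rel_capE.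
Qed.

Lemma generated_converse m n (f : linrel k m n) :
  gen f -> gen (rel_converse f).
Proof.
elim=> {m n f} [m n f [] {m n f}|n|m n|m n p g f _ IHg _ IHf
  |m n p q f g _ IHf _ IHg].
- exact: generated_converse_add.
- exact: generated_converse_zero.
- exact: generated_converse_dup.
- exact: generated_converse_del.
- exact: generated_converse_scale.
- rewrite rel_converse_cup; exact: generated_cap.
- rewrite rel_converse_cap; exact: generated_cup.
- rewrite rel_converse_id; exact: generated_id.
- rewrite rel_converse_braid; exact: generated_braid.
- rewrite rel_converse_comp; exact: generated_comp IHf IHg.
- rewrite rel_converse_tens; exact: generated_tens IHf IHg.
Qed.

(** * Subspaces as kernels *)

Lemma linear_row_mx m (V : vectType k) (f : 'rV[k]_m -> V) :
  linear f -> exists A : 'M_(m, dim V), forall x, v2r (f x) = x *m A.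
Proof.
move=> lf; pose g : {linear 'rV[k]_m -> V} :=
  HB.pack f (GRing.isLinear.Build k 'rV[k]_m V *:%R f lf).
by exists (lin1_mx (v2r \o g)) => x; rewrite mul_rV_lin1.
Qed.

(** The subspace [L] is the kernel of [phi], the identity minus a projection
onto [L], and [phi (x, y) = phi (x, 0) - phi (0, - y)]. *)
Lemma linrel_equalizer m n (L : linrel k m n) :
  exists p (A : 'M_(m, p)) (B : 'M_(n, p)),
    forall x y, ((x, y) \in L) = (x *m A == y *m B).
Proof.
pose U := ('rV[k]_m * 'rV[k]_n)%type.
pose phi : 'End(U) := (\1 - projv L)%VF.
have memL u : (u \in L) = (phi u == 0).
  rewrite /phi add_lfunE opp_lfunE id_lfunE subr_eq0.
  apply/idP/eqP => [/projv_id-> //|->]; exact: memv_proj.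
have [A AE] : exists A : 'M_(m, dim U), forall x, v2r (phi (x, 0)) = x *m A.
  apply: linear_row_mx => a x y; rewrite -linearP; congr (phi _).
  by congr pair; rewrite /= scaler0 addr0.
have [B BE] : exists B : 'M_(n, dim U), forall y, v2r (phi (0, - y)) = y *m B.
  apply: linear_row_mx => a x y; rewrite -linearP; congr (phi _).
  by congr pair; rewrite /= ?scaler0 ?addr0 // opprD scalerN.
exists (dim U), A, B => x y; rewrite -AE -BE (inj_eq (@v2r_inj k U)) memL.
rewrite -[RHS]subr_eq0 -linearB; congr (phi _ == 0).
by congr pair; rewrite /= ?subr0 // sub0r opprK.
Qed.

End Generation.

Theorem mainTheorem8 (k : fieldType) :
  is_generated_by (P := FinRel k) (@FinRel_generator k).
Proof.
move=> m n L; have [p [A [B LE]]] := linrel_equalizer L.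
suff -> : L = rel_comp (rel_converse (rel_graph B)) (rel_graph A).
  apply: generated_comp (generated_graph A).
  exact/generated_converse/generated_graph.
apply: linrelP => x y; rewrite LE; apply/eqP/mem_rel_comp => [xA|[v []]].
  by exists (x *m A); rewrite mem_rel_converse !mem_rel_graph xA eqxx.
by rewrite mem_rel_converse !mem_rel_graph => /eqP-> /eqP.
Qed.
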